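(* Let $(\mathfrak h,(H_i,L_i)_{i\in I})$ be a linear Coxeter system with linear Coxeter group $\mathcal W$, closed fundamental chamber $\overline C$ and Tits cone $X$. Let $Y\subseteq X$ be a $\mathcal W$-invariant convex subcone containing $0$. Then $\Upsilon$ is a complete sublattice of $\mathrm{Fa}(Y)$.
   Context: $\mathbb R^+=(0,\infty)$. A convex cone is a subset of a real vector space closed under addition and under multiplication by elements of $\mathbb R^+$. $\mathrm{ri}$ denotes the relative interior of a finite-dimensional convex set. For a convex cone $K$ containing $0$, a face of $K$ is a convex cone $F\subseteq K$ with $(K\setminus F)+K\subseteq K\setminus F$; $\mathrm{Fa}(K)$ is the set of nonempty faces, ordered by inclusion. It is a complete lattice with meet given by intersection; its biggest element is $K$ and its smallest element is $K\cap(-K)$. A complete sublattice of $\mathrm{Fa}(Y)$ is a subset that contains the smallest and the biggest element of $\mathrm{Fa}(Y)$ and contains the meets and joins, formed in $\mathrm{Fa}(Y)$, of all its nonempty subsets. Linear Coxeter systems. Let $\mathfrak h$ be a finite-dimensional real vector space, $n\ge1$, $I=\{1,\dots,n\}$. For a zero-based closed ray $H\subseteq\mathfrak h$ put $H^{\ge0}=\{\lambda\in\mathfrak h^*\mid\lambda(h)\ge0\ \forall h\in H\}$, $H^{>0}=\{\lambda\mid\lambda(h)>0\ \forall h\in H\setminus\{0\}\}$, $H^{=0}=\{\lambda\mid\lambda(h)=0\ \forall h\in H\}$. A linear Coxeter system $(\mathfrak h,(H_i,L_i)_{i\in I})$ consists of zero-based closed rays $H_i\subseteq\mathfrak h$,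 $L_i\subseteq\mathfrak h^*$ with $L_i\setminus\{0\}\subseteq H_i^{>0}$ such that: (1) the closed fundamental chamber $\overline C=\bigcap_{i\in I}H_i^{\ge0}$ spans $\mathfrak h^*$, and $\overline C\cap H_i^{=0}$, $i\in I$, are its pairwise different faces of codimension 1; (2) with $C=\bigcap_{i\in I}H_i^{>0}$ and $\mathcal W$ (the linear Coxeter group) the group generated by the reflections $\sigma_i$ on $\mathfrak h^*$ at the hyperplane $H_i^{=0}$ along the line $L_i\cup(-L_i)$, one has $\sigma C\cap C=\emptyset$ for all $\sigma\in\mathcal W\setminus\{1\}$. The Tits cone is the convex cone $X=\bigcup_{\sigma\in\mathcal W}\sigma\overline C$. $\Upsilon=\{R\in\mathrm{Fa}(Y)\mid\mathrm{ri}(R)\cap\overline C\ne\emptyset\}$. *)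

(* Defs.v *)
From HB Require Import structures.
From mathcomp Require Import all_boot all_order all_algebra.
From mathcomp Require Import all_classical all_reals all_analysis.

Set Implicit Arguments.
Unset Strict Implicit.
Unset Printing Implicit Defensive.

Import Order.TTheory GRing.Theory Num.Theory.
Import numFieldNormedType.Exports VectorInternalTheory.

Local Open Scope classical_set_scope.
Local Open Scope ring_scope.

Section OrderedFamilies.
Variable T : Type.
Implicit Types (P U S : set (set T)) (A B M : set T).

Definition is_smallest P M := P M /\ forall A, P A -> M `<=` A.

Definition is_biggest P M := P M /\ forall A, P A -> A `<=` M.

(* Meets and joins are formed in the poset (P, `<=`), not in the power set. *)
Definition is_meet P S M :=
  is_biggest [set B | P B /\ forall A, S A -> B `<=` A] M.

Definition is_join P S M :=
  is_smallest [set B | P B /\ forall A, S A -> A `<=` B] M.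

Definition complete_sublattice P U :=
  [/\ U `<=` P,
      exists2 M, U M & is_smallest P M,
      exists2 M, U M & is_biggest P M,
      forall S, S `<=` U -> S !=set0 -> exists2 M, U M & is_meet P S M
    & forall S, S `<=` U -> S !=set0 -> exists2 M, U M & is_join P S M].

End OrderedFamilies.

Section Convexity.
Variables (R : realType) (V : vectType R).
Implicit Types (A K F : set V).

Definition convex_cone K :=
  (forall x y, K x -> K y -> K (x + y)) /\
  (forall (a : R) x, 0 < a -> K x -> K (a *: x)).

Definition face K F :=
  [/\ convex_cone F, F `<=` K &
      forall x y, (K `\` F) x -> K y -> (K `\` F) (x + y)].

Definition Fa K : set (set V) := [set F | face K F /\ F !=set0].

Definition linear_span A : set V :=
  [set v | exists2 s : seq V, (forall x, x \in s -> A x) & v \in span s].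

Definition affine_hull A : set V :=
  [set v | exists m (c : 'I_m -> R) (x : 'I_m -> V),
     [/\ forall i, A (x i), \sum_i c i = 1 & v = \sum_i c i *: x i]].

(* [v2r] is a linear isomorphism of V onto a space of row vectors, so that the
   pullback of the topology of row vectors is the usual topology of V. *)
Definition relint A : set V :=
  [set x | A x /\
     \forall u \near (v2r x : 'rV[R]_(dim V)), affine_hull A (r2v u) -> A (r2v u)].

(* Codimension is only taken for sets containing 0, whose affine hull is their
   linear span. *)
Definition codim1 A :=
  exists2 U : {vspace V}, [set` U] = linear_span A & (\dim U).+1 = \dim {:V}.

Definition closed_ray A :=
  exists2 v : V, v != 0 & A = [set t *: v | t in [set t : R | 0 <= t]].

Definition linear_group (G : set 'End(V)) :=
  [/\ G \1%VF,
      forall s t, G s -> G t -> G (s \o t)%VF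
    & forall s, G s -> exists t, [/\ G t, (s \o t)%VF = \1%VF & (t \o s)%VF = \1%VF]].

End Convexity.

Definition dual (R : realType) (h : vectType R) : vectType R := 'Hom(h, R^o).

Section LinearCoxeterSystems.
Variables (R : realType) (h : vectType R) (n : nat).

Definition ge0_on (A : set h) : set (dual h) :=
  [set l : 'Hom(h, R^o) | forall x, A x -> 0 <= l x :> R].

Definition gt0_on (A : set h) : set (dual h) :=
  [set l : 'Hom(h, R^o) | forall x, A x -> x != 0 -> 0 < l x :> R].

Definition eq0_on (A : set h) : set (dual h) :=
  [set l : 'Hom(h, R^o) | forall x, A x -> l x = 0 :> R].

Variables (H : 'I_n -> set h) (L : 'I_n -> set (dual h)).

Definition closed_chamber : set (dual h) := \bigcap_(i in setT) ge0_on (H i).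

Definition open_chamber : set (dual h) := \bigcap_(i in setT) gt0_on (H i).

(* If [L i] is a ray with nonzero elements in [gt0_on (H i)], then the dual is
   the direct sum of [eq0_on (H i)] and of the line spanned by [L i], and there
   is exactly one such [s]. *)
Definition simple_reflection (i : 'I_n) (s : 'End(dual h)) :=
  (forall l, eq0_on (H i) l -> s l = l) /\ (forall l, L i l -> s l = - l).

Definition coxeter_group : set 'End(dual h) :=
  smallest (@linear_group R (dual h))
           [set s | exists i, simple_reflection i s].

Definition tits_cone : set (dual h) :=
  \bigcup_(s in coxeter_group) [set s l | l in closed_chamber].

Record linear_coxeter_system : Prop := LinearCoxeterSystem {
  lcs_rank : (0 < n)%N;
  lcs_ray : forall i, closed_ray (H i);
  lcs_coray : forall i, closed_ray (L i);
  lcs_pos : forall i l, L i l -> l != 0 -> gt0_on (H i) l;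
  lcs_span : linear_span closed_chamber = setT;
  lcs_facets : [set F | Fa closed_chamber F /\ codim1 F] =
    range (fun i => closed_chamber `&` eq0_on (H i));
  lcs_facets_inj : injective (fun i => closed_chamber `&` eq0_on (H i));
  lcs_disjoint : forall s, coxeter_group s -> s <> \1%VF ->
    [set s l | l in open_chamber] `&` open_chamber = set0
}.

Definition Upsilon (Y : set (dual h)) : set (set (dual h)) :=
  [set F | Fa Y F /\ relint F `&` closed_chamber !=set0].

End LinearCoxeterSystems.

(* Main.v *)
(* The face of [Y] generated by [r] is the only face with [r] in its relative
   interior, so [Upsilon] consists of the faces generated by the points of [Y]
   in the closed chamber.  A join of such faces is generated by a relatively
   interior point of the cone of those points of the closed chamber that lie in
   all upper bounds.

   For meets, let [A] be generated by a dominant [r], let [x] be in [A], and let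
   [x] be negative on the simple root [i].  Then [s i x] is in [A]: either [s i]
   fixes [r], hence [A], or a positive combination of [x] and [r] lies on the
   wall [i], is a positive combination of [s i x] and [s i r] as well, and [A] is
   a face.  So an intersection [M] of such faces is closed under these foldings,
   and folding a relatively interior point of [M] keeps it relatively interior.
   By the deletion property of the group, folding ends in the closed chamber. *)

Require Import Defs.
From HB Require Import structures.
From mathcomp Require Import all_boot all_order all_algebra.
From mathcomp Require Import all_classical all_reals all_analysis.

Set Implicit Arguments.
Unset Strict Implicit.
Unset Printing Implicit Defensive.

Import Order.TTheory GRing.Theory Num.Theory.
Import numFieldNormedType.Exports VectorInternalTheory.

Local Open Scope classical_set_scope.
Local Open Scope ring_scope.

(** * Cones, relative interiors and faces *)

Section Cones.
Variables (R : realType) (V : vectType R).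
Implicit Types (K F Y : set V) (r x y : V).

(* By [relint_coneE], the relative interior of a convex cone containing 0. *)
Definition cone_core K : set V :=
  [set x | K x /\ forall y, K y -> exists2 e : R, 0 < e & K (x - e *: y)].

(** For a convex cone [Y] with 0 and [r] in [Y], this is the smallest face of [Y] containing [r]. *)
Definition face_of Y r : set V :=
  [set y | Y y /\ exists2 e : R, 0 < e & Y (r - e *: y)].

Lemma cone_sum K (I : Type) (s : seq I) (P : pred I) (f : I -> V) :
  convex_cone K -> K 0 -> (forall i, P i -> K (f i)) ->
  K (\sum_(i <- s | P i) f i).
Proof. by move=> [KD _] K0 Kf; apply: big_ind. Qed.

Lemma coneZ0 K (a : R) x : convex_cone K -> K 0 -> 0 <= a -> K x -> K (a *: x).
Proof.
move=> [_ KZ] K0; rewrite le_eqVlt => /predU1P[<- _|a0 Kx]; first by rewrite scale0r.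
exact: KZ.
Qed.

Lemma coneZV K (a : R) x : convex_cone K -> 0 < a -> K (a *: x) -> K x.
Proof.
move=> [_ KZ] a0 /(KZ a^-1); rewrite invr_gt0 scalerA mulVf ?gt_eqF// scale1r.
exact.
Qed.

(** A free family in [K] of maximal length spans [K], since a point outside its span could be added
    to it. *)
Lemma cone_basis K : exists m (b : m.-tuple V),
  [/\ free b, forall i : 'I_m, K b`_i & forall x, K x -> x \in <<b>>%VS].
Proof.
pose P m := `[< exists b : m.-tuple V, free b /\ forall i : 'I_m, K b`_i >].
have exP : exists m, P m.
  by exists 0; apply/asboolP; exists [tuple]; split; [rewrite nil_free|case].
have ubP m : P m -> (m <= \dim {:V})%N.
  move=> /asboolP[b [/eqP fb _]]; rewrite -(size_tuple b) -fb.
  exact/dimvS/subvf.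
case: (ex_maxnP exP ubP) => m /asboolP[b [fb Kb]] maxm.
exists m, b; split=> // x Kx; apply/negPn/negP => xb.
suff /maxm : P m.+1 by rewrite ltnn.
apply/asboolP; exists (cons_tuple x b); split; first by rewrite free_cons xb.
by case=> -[|i] //= im; apply: (Kb (Ordinal (im : (i < m)%N))).
Qed.

(** The sum of a basis taken from [K] works: its coordinates are all 1, so they stay nonnegative
    when a small multiple of a point of [K] is subtracted. *)
Lemma cone_core_neq0 K : convex_cone K -> K 0 -> cone_core K !=set0.
Proof.
move=> Kc K0; have [m [b [_ Kb bK]]] := cone_basis K.
exists (\sum_(i < m) b`_i); split; first exact: cone_sum.
move=> y /bK/coord_span ->.
pose M : R := 1 + \sum_(i < m) `|coord b i y|.
have M0 : 0 < M by rewrite ltr_pwDl// sumr_ge0.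
exists M^-1; first by rewrite invr_gt0.
rewrite scaler_sumr -sumrB; apply: cone_sum => // i _.
rewrite scalerA -[X in X - _]scale1r -scalerBl; apply: coneZ0 => //.
rewrite subr_ge0 mulrC ler_pdivrMr// mul1r /M (bigD1 i)//=.
by rewrite (le_trans (ler_norm _))// addrCA lerDl addr_ge0// sumr_ge0//.
Qed.

Lemma affine_hull_span K m (b : m.-tuple V) :
  (forall x, K x -> x \in <<b>>%VS) ->
  forall x, affine_hull K x -> x \in <<b>>%VS.
Proof.
move=> bK x [k [c [f [Kf _ ->]]]]; apply: memv_suml => i _.
exact/memvZ/bK.
Qed.

Lemma linear_rV_continuous k (f : {linear 'rV[R]_k -> R^o}) :
  continuous (f : 'rV[R]_k -> R).
Proof.
rewrite (_ : (f : 'rV[R]_k -> R) = (fun v => \sum_j v 0 j * f (delta_mx 0 j) : R)).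
  apply: continuous_big => [|j _ u]; first exact: add_continuous.
  by apply: (@cvgMr_tmp _ _ _ _ _ _ _ (@coord_continuous R 1 k 0 j u)).
apply/funext => v; rewrite {1}(row_sum_delta v) linear_sum; apply: eq_bigr => j _.
by rewrite linearZ.
Qed.

Lemma relint_coneE K : convex_cone K -> K 0 -> relint K = cone_core K.
Proof.
move=> Kc K0; have [KD _] := Kc.
apply/seteqP; split=> x [Kx xK]; split=> //.
  move=> y Ky.
  have cvx : (fun e : R => v2r x - e *: v2r y) @ 0^'+ --> (v2r x : 'rV[R]_(dim V)).
    rewrite -[X in _ --> X]subr0 -(scale0r (v2r y)).
    apply: cvgB; first exact: cvg_cst.
    by apply: cvgZr_tmp; exact: cvg_at_right_filter.
  have xyK := cvx _ xK; near (0:R)^'+ => e.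
  exists e => //.
  have : affine_hull K (r2v (v2r x - e *: v2r y)) -> K (r2v (v2r x - e *: v2r y)).
    by near: e.
  rewrite -linearZ -linearB v2rK; apply.
  (* The weights 1, [e], [- e] have sum 1; the point 0 takes up the weight [e]. *)
  exists 3%N, (fun i : 'I_3 => [:: 1; e; - e]`_i), (fun i : 'I_3 => [:: x; 0; y]`_i); split.
  - by case=> -[|[|[]]].
  - by rewrite !big_ord_recl big_ord0 /= addr0 subrr addr0.
  - by rewrite !big_ord_recl big_ord0 /= addr0 scaler0 add0r scale1r scaleNr.
have [m [b [fb Kb bK]]] := cone_basis K.
(* [x] minus [d] times the sum of the basis is still in [K]. Points of the span with coordinates
   closer than [d] to those of [x] arise from it by adding nonnegative multiples of basis
   vectors. *)
have [|d d0 Kd] := xK (\sum_(i < m) b`_i); first exact: cone_sum.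
have cont i : \forall u \near (v2r x : 'rV[R]_(dim V)),
    `|coord b i x - coord b i (r2v u)| < d.
  pose f : {linear 'rV[R]_(dim V) -> R^o} := coord b i \o r2v.
  have := @linear_rV_continuous _ f (v2r x).
  by move=> /cvgrPdist_lt/(_ _ d0); rewrite /f/= v2rK.
near=> u => /(affine_hull_span bK) ub.
have ud i : `|coord b i x - coord b i (r2v u)| < d.
  by move: i; near: u; apply: filter_forall.
have -> : r2v u = x - d *: (\sum_(i < m) b`_i) +
    \sum_(i < m) (d - (coord b i x - coord b i (r2v u))) *: b`_i.
  under [X in _ + X]eq_bigr do rewrite scalerBl.
  rewrite sumrB -scaler_sumr addrA subrK.
  under eq_bigr do rewrite scalerBl.
  rewrite sumrB -!coord_span//; last exact: bK.
  by rewrite subKr.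
apply: KD => //; apply: cone_sum => // i _; apply: coneZ0 => //.
by rewrite subr_ge0 (le_trans (ler_norm _))// ltW.
Unshelve. all: by end_near. Qed.

(** * Faces generated by points *)

Section Faces.
Variable Y : set V.
Hypotheses (Ycone : convex_cone Y) (Y0 : Y 0).

Lemma face0 F : Fa Y F -> F 0.
Proof.
move=> [[_ FsY FY] [x Fx]]; apply: contrapT => F0.
by have [] := FY 0 x (conj Y0 F0) (FsY _ Fx); rewrite add0r.
Qed.

Lemma face_of_self r : Y r -> face_of Y r r.
Proof. by move=> Yr; split=> //; exists 1 => //; rewrite scale1r subrr. Qed.

Lemma face_of_Fa r : Y r -> Fa Y (face_of Y r).
Proof.
have [YD YZ] := Ycone.
move=> Yr; split; last by exists r; exact: face_of_self.
split=> [|y []//|x y [Yx rx] Yy].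
  split=> [x y [Yx [d d0 rx]] [Yy [e e0 ry]]|a x a0 [Yx [e e0 rx]]].
    split; first exact: YD.
    (* Averaging [r - d *: x] and [r - e *: y] with weights [e / (d + e)] and [d / (d + e)] gives
       [x] and [y] this same coefficient. *)
    exists (d * e / (d + e)); first by rewrite divr_gt0 ?mulr_gt0 ?addr_gt0.
    have -> : r - (d * e / (d + e)) *: (x + y) =
      (e / (d + e)) *: (r - d *: x) + (d / (d + e)) *: (r - e *: y).
      rewrite !scalerBr !scalerA addrACA -opprD -scalerDl -mulrDl scalerDr.
      rewrite [e + d]addrC mulfV ?gt_eqF ?addr_gt0// scale1r.
      by congr (_ - (_ *: _ + _ *: _)); rewrite [RHS]mulrAC// [e * d]mulrC.
    by apply: YD; apply: YZ => //; rewrite divr_gt0// addr_gt0.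
  split; first exact: YZ.
  by exists (e / a); rewrite ?divr_gt0// scalerA divfK// gt_eqF.
split; first exact: YD.
move=> [_ [e e0 rxy]]; apply: rx; split=> //; exists e => //.
have -> : r - e *: x = r - e *: (x + y) + e *: y.
  by rewrite scalerDr opprD addrA subrK.
by apply: YD => //; apply: YZ.
Qed.

(** [r] is the sum of [e *: y] and a point of [Y]; since [F] is a face, a summand outside [F] would
    force [r] out of [F]. *)
Lemma face_of_sub F r : Fa Y F -> F r -> face_of Y r `<=` F.
Proof.
move=> [[[FD FZ] FsY FY] _] Fr y [Yy [e e0 ry]]; apply: contrapT => Fy.
have Fey : (Y `\` F) (e *: y).
  split; first exact: Ycone.2.
  by move=> Fey; apply: Fy; exact: coneZV Fey.
by have [_] := FY _ _ Fey ry; rewrite addrC subrK.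
Qed.

Lemma face_of_core F r : Fa Y F -> cone_core F r -> F = face_of Y r.
Proof.
move=> FF [Fr rF]; apply/seteqP; split; last exact: face_of_sub.
have [[_ FY _] _] := FF.
by move=> y Fy; split; [exact: FY|have [e e0 /FY] := rF _ Fy; exists e].
Qed.

Lemma core_face_of r : Y r -> cone_core (face_of Y r) r.
Proof.
move=> Yr; split; first exact: face_of_self.
move=> y [Yy [e e0 ry]]; exists e => //; split=> //; exists 1 => //.
by rewrite scale1r subKr; exact: Ycone.2.
Qed.

Lemma face_cone F : Fa Y F -> convex_cone F.
Proof. by move=> [[]]. Qed.

Lemma face_ofE F : Fa Y F -> exists2 r, Y r & F = face_of Y r.
Proof.
move=> FF; have [r rF] := cone_core_neq0 (face_cone FF) (face0 FF).
by exists r; [case: FF => -[_ FY _] _; exact/FY/rF.1|exact: face_of_core].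
Qed.

Lemma relint_faceP F r : Fa Y F -> relint F r <-> Y r /\ F = face_of Y r.
Proof.
move=> FF; rewrite relint_coneE; [|exact: face_cone|exact: face0].
split=> [rF|[Yr ->]]; last exact: core_face_of.
by split; [case: FF => -[_ FY _] _; exact/FY/rF.1|exact: face_of_core].
Qed.

Lemma Fa_full : Fa Y Y.
Proof.
by split; [split=> // x y [Yx] /(_ Yx)|exists 0].
Qed.

Lemma Fa_bigcap (S : set (set V)) : S `<=` Fa Y -> S !=set0 ->
  Fa Y (\bigcap_(A in S) A).
Proof.
move=> SY [A0 SA0]; split; last by exists 0 => A /SY/face0.
split=> [|x /(_ _ SA0)|x y [Yx xS] Yy]; first split=> [x y xS yS A SA|a x a0 xS A SA].
- by apply: (face_cone (SY _ SA)).1; [exact: xS|exact: yS].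
- by apply: (face_cone (SY _ SA)).2 => //; exact: xS.
- by have [[_ + _] _] := SY _ SA0; apply.
- split; first exact: Ycone.1.
  move=> xyS; apply: xS => A SA; apply: contrapT => Ax.
  have [[_ _ AY] _] := SY _ SA.
  by have [_] := AY x y (conj Yx Ax) Yy; apply; exact: xyS.
Qed.

Lemma face_of_img (s : 'End(V)) r : injective s -> [set s x | x in Y] = Y ->
  face_of Y (s r) = [set s x | x in face_of Y r].
Proof.
move=> sI sY.
have YsP x : Y (s x) -> Y x by rewrite -{1}sY => -[y Yy /sI <-].
have Ys x : Y x -> Y (s x) by move=> Yx; rewrite -sY; exists x.
apply/seteqP; split=> [y [+ [e e0 ry]]|_ [x [Yx [e e0 rx]] <-]].
  rewrite -{1}sY => -[x Yx xy]; exists x => //; split=> //; exists e => //.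
  by apply: YsP; rewrite linearB linearZ /= xy.
by split; [exact: Ys|exists e => //; rewrite -linearZ -linearB; exact: Ys].
Qed.

End Faces.
End Cones.

(** * Groups generated by simple reflections *)

Section ReflectionGroups.
Variables (R : realType) (V : vectType R) (n : nat).
Variables (alpha : 'I_n -> {scalar V}) (d : 'I_n -> V) (s : 'I_n -> 'End(V)).
Implicit Types (i j k : 'I_n) (ws : seq 'I_n) (x y : V).

Definition dominant : set V := [set x | forall i, 0 <= alpha i x].
Definition dominant_open : set V := [set x | forall i, 0 < alpha i x].

Definition word ws : 'End(V) := foldr (fun i g => (s i \o g)%VF) \1%VF ws.

Hypothesis alpha_d : forall i, alpha i (d i) = 2.
Hypothesis sE : forall i x, s i x = x - alpha i x *: d i.
Hypothesis dominant_span : linear_span dominant = setT.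
(** This is what codimension 1 of the facets provides. *)
Hypothesis wall_span : forall i (f : {scalar V}),
  (forall x, dominant x -> alpha i x = 0 -> f x = 0) ->
  exists c : R, forall x, f x = c * alpha i x.
Hypothesis wall_inj : forall i k,
  (forall x, dominant x -> alpha i x = 0 <-> alpha k x = 0) -> i = k.
Hypothesis word_disjoint : forall ws x,
  dominant_open x -> dominant_open (word ws x) -> word ws = \1%VF.

Lemma word_cat ws1 ws2 x : word (ws1 ++ ws2) x = word ws1 (word ws2 x).
Proof.
elim: ws1 => [|i ws1 IH] /=; first by rewrite id_lfunE.
by rewrite !comp_lfunE IH.
Qed.

Lemma word_rcons ws i x : word (rcons ws i) x = word ws (s i x).
Proof. by rewrite -cats1 word_cat /= comp_lfunE id_lfunE. Qed.

Lemma alpha_s i x : alpha i (s i x) = - alpha i x.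
Proof. by rewrite sE linearB linearZ /= alpha_d mulr_natr mulr2n opprD addNKr. Qed.

Lemma sK i : involutive (s i).
Proof.
by move=> x; rewrite [LHS]sE alpha_s sE scaleNr opprK subrK.
Qed.

Lemma s_fix i x : alpha i x = 0 -> s i x = x.
Proof. by move=> ix; rewrite sE ix scale0r subr0. Qed.

Lemma wordK ws x : word (rev ws) (word ws x) = x.
Proof.
elim: ws x => [|i ws IH] x /=; first by rewrite !id_lfunE.
by rewrite rev_cons word_rcons comp_lfunE sK.
Qed.

Lemma wordVK ws x : word ws (word (rev ws) x) = x.
Proof. by rewrite -{1}(revK ws) wordK. Qed.

(** * The open chamber, its walls and the deletion property *)

Lemma dominant_openW x : dominant_open x -> dominant x.
Proof. by move=> xC i; exact/ltW/xC. Qed.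

Lemma dominant_openD x y : dominant x -> dominant_open y -> dominant_open (x + y).
Proof. by move=> xC yC i; rewrite linearD; exact: ltr_wpDl (xC i) (yC i). Qed.

Lemma dominant_openZ (a : R) x : 0 < a -> dominant_open x -> dominant_open (a *: x).
Proof. by move=> a0 xC i; rewrite linearZ; exact: mulr_gt0 (xC i). Qed.

(** A root vanishing on the chamber would vanish on its span, hence at [d i]. So each root is
    positive at some dominant point, and these points are added up. *)
Lemma dominant_open_neq0 : dominant_open !=set0.
Proof.
have /choice[q qP] i : exists x, dominant x /\ 0 < alpha i x.
  apply: contrapT => noq.
  suff : alpha i (d i) = 0 by rewrite alpha_d => /eqP; rewrite pnatr_eq0.
  have : linear_span dominant (d i) by rewrite dominant_span.
  move=> [t tC] /(@coord_span _ _ _ (in_tuple t)) ->; rewrite linear_sum big1// => j _.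
  rewrite linearZ /=; have jC : dominant t`_j by apply/tC/mem_nth.
  apply/eqP; rewrite mulf_eq0; apply/orP; right; rewrite eq_le jC andbT leNgt.
  by apply/negP => ij; apply: noq; exists t`_j.
exists (\sum_k q k) => i; rewrite linear_sum (bigD1 i)//= ltr_pwDl ?(qP i).2//.
by apply: sumr_ge0 => k _; exact: (qP k).1.
Qed.

(** If [alpha k] vanished on the facet of [j], it would be a nonzero multiple of [alpha j], and the
    facets of [j] and [k] would coincide. *)
Lemma generic_wall_point j : exists p,
  alpha j p = 0 /\ forall k, k != j -> 0 < alpha k p.
Proof.
have /choice[q qP] k : exists x, [/\ dominant x, alpha j x = 0 & k != j -> 0 < alpha k x].
  have [->|kj] := eqVneq k j.
    by exists 0; split=> [i||]; rewrite ?linear0.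
  apply: contrapT => noq.
  have k0 x : dominant x -> alpha j x = 0 -> alpha k x = 0.
    move=> xC jx; apply/eqP; rewrite eq_le xC andbT leNgt.
    by apply/negP => kx; apply: noq; exists x.
  have [c kc] := wall_span k0.
  suff : j = k by move=> jk; rewrite jk eqxx in kj.
  apply: wall_inj => x xC; split; first exact: k0.
  rewrite kc => /eqP; rewrite mulf_eq0 => /predU1P[c0|/eqP//].
  by have /eqP := kc (d k); rewrite alpha_d c0 mul0r pnatr_eq0.
exists (\sum_k q k); split=> [|k kj]; rewrite linear_sum.
  by apply: big1 => k _; case: (qP k).
rewrite (bigD1 k)//= ltr_pwDl//; first by case: (qP k) => _ _; apply.
by apply: sumr_ge0 => i _; case: (qP i) => + _ _; apply.
Qed.

(* The vector [t *: p + c0] is, up to scaling, a small perturbation of a generic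
   point [p] of the wall [j], so that both it and its image lie in the chamber. *)
Lemma word_fix_wall ws j :
  (forall x, alpha j x = 0 -> word ws x = x) ->
  (forall x, alpha j (word ws x) = alpha j x) -> word ws = \1%VF.
Proof.
move=> wfix wpos.
have [c0 C0] := dominant_open_neq0.
have [p [jp kp]] := generic_wall_point j.
have p0 : dominant p.
  by move=> k; have [->|/kp/ltW//] := eqVneq k j; rewrite jp.
pose t := 1 + \sum_k `|alpha k (word ws c0)| / alpha k p.
have nn k : 0 <= `|alpha k (word ws c0)| / alpha k p by rewrite divr_ge0 ?p0.
have t0 : 0 < t by rewrite ltr_pwDl// sumr_ge0.
apply: (@word_disjoint _ (t *: p + c0)).
  by apply: dominant_openD => // i; rewrite linearZ mulr_ge0 ?p0// ltW.
move=> k; have [->|kj] := eqVneq k j; first by rewrite wpos linearD linearZ/= jp mulr0 add0r.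
rewrite linearD linearZ /= wfix// linearD linearZ /= -ltrBlDr sub0r.
rewrite (le_lt_trans (ler_norm _))// normrN -ltr_pdivrMr ?kp//.
by rewrite /t (bigD1 k)//= addrCA ltrDl ltr_pwDl// sumr_ge0.
Qed.

(** If [word ws] moved a point [x] of the open chamber onto wall [i], then the conjugate of [s i] by
    [word ws] would fix [x] and so be the identity, although [s i] negates [alpha i (d i)]. By
    convexity the image of the open chamber then lies on one side. *)
Lemma wall_side ws i :
  (forall x, dominant_open x -> 0 < alpha i (word ws x)) \/
  (forall x, dominant_open x -> alpha i (word ws x) < 0).
Proof.
have neq0 x : dominant_open x -> alpha i (word ws x) <> 0.
  move=> xC ix.
  have uE y : word (rev ws ++ i :: ws) y = word (rev ws) (s i (word ws y)).
    by rewrite word_cat /= comp_lfunE.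
  have u1 : word (rev ws ++ i :: ws) = \1%VF.
    by apply: (@word_disjoint _ x) => //; rewrite uE s_fix// wordK.
  have := congr1 (word ws) (uE (word (rev ws) (d i))).
  rewrite u1 id_lfunE !wordVK => /(congr1 (alpha i)).
  by rewrite alpha_s alpha_d => /eqP; rewrite -addr_eq0 -natrD pnatr_eq0.
apply: contrapT => /not_orP[/existsNP[x /not_implyP[xC /negP]]].
rewrite -leNgt => ix /existsNP[y /not_implyP[yC /negP]].
rewrite -leNgt => iy.
have ix0 : alpha i (word ws x) < 0 by rewrite lt_neqAle ix andbT; apply/eqP/neq0.
have iy0 : 0 < alpha i (word ws y) by rewrite lt_def iy andbT; apply/eqP/neq0.
apply: (neq0 (alpha i (word ws y) *: x + (- alpha i (word ws x)) *: y)).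
  apply: dominant_openD; last by apply: dominant_openZ => //; rewrite oppr_gt0.
  exact/dominant_openW/dominant_openZ.
by rewrite !linearD !linearZ /= mulNr mulrC subrr.
Qed.

Lemma dominant_closure (f : {scalar V}) :
  (forall x, dominant_open x -> 0 < f x) -> forall x, dominant x -> 0 <= f x.
Proof.
move=> fC x xC; rewrite leNgt; apply/negP => fx.
have [c C0] := dominant_open_neq0.
(* The multiple of [c] is chosen so that [f] vanishes at the sum. *)
have /fC : dominant_open (x + (- f x / f c) *: c).
  by apply: dominant_openD => //; apply: dominant_openZ => //; rewrite divr_gt0 ?oppr_gt0 ?fC.
by rewrite linearD linearZ /= divfK ?gt_eqF ?fC// subrr ltxx.
Qed.

Lemma wall_sideP ws i c : dominant c ->
  (forall x, dominant_open x -> 0 < alpha i (word ws x)) -> 0 <= alpha i (word ws c).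
Proof. by move=> cC wpos; exact: (@dominant_closure (alpha i \o word ws)). Qed.

Lemma wall_sideN ws i c : dominant c ->
  (forall x, dominant_open x -> alpha i (word ws x) < 0) -> alpha i (word ws c) <= 0.
Proof.
move=> cC wneg; rewrite -oppr_ge0.
by apply: (@dominant_closure (- (alpha i \o word ws))) => //= x /wneg; rewrite oppr_gt0.
Qed.

(** As letters are appended to the word, the images of the open chamber cross wall [i] at some
    letter [j]; applying [s i] amounts to deleting that letter. *)
Lemma deletion ws i c : dominant c -> alpha i (word ws c) < 0 ->
  exists2 ws', (size ws' < size ws)%N & forall x, s i (word ws x) = word ws' x.
Proof.
have [c0 C0] := dominant_open_neq0.
elim/last_ind: ws c => [c cC|ws j IH c cC].
  by rewrite id_lfunE ltNge cC.
have [wpos|wneg] := wall_side ws i; last first.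
  move=> _; have [ws' ws'_lt ws'E] := IH _ (dominant_openW C0) (wneg _ C0).
  exists (rcons ws' j); first by rewrite !size_rcons.
  by move=> x; rewrite !word_rcons.
have [wjpos|wjneg] := wall_side (rcons ws j) i.
  by rewrite ltNge (wall_sideP cC wjpos).
move=> _; exists ws; first by rewrite size_rcons.
(* Points of the facet [j] are fixed by [s j], so their images lie on both closed sides of wall [i],
   hence on it. *)
have [b bE] : exists b : R, forall x, alpha i (word ws x) = b * alpha j x.
  apply: (@wall_span j (alpha i \o word ws)) => x xC jx; apply/eqP; rewrite eq_le /= (wall_sideP xC wpos) andbT.
  by have := wall_sideN xC wjneg; rewrite word_rcons s_fix.
have b0 : b != 0.
  by apply/eqP => b0; have := wpos _ C0; rewrite bE b0 mul0r ltxx.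
(* [s i] and the conjugate of [s j] by [word ws] are reflections in the same
   wall; that they also have the same root follows from [word_disjoint]. *)
pose u := rev ws ++ i :: rcons ws j.
have uE x : word u x = word (rev ws) (s i (word ws (s j x))).
  by rewrite word_cat /= comp_lfunE word_rcons.
have u1 : word u = \1%VF.
  apply: (@word_fix_wall _ j) => x.
    by move=> jx; rewrite uE (s_fix jx) s_fix ?wordK// bE jx mulr0.
  by apply: (mulfI b0); rewrite -bE uE wordVK alpha_s bE alpha_s mulrN opprK.
by move=> x; rewrite word_rcons -[s i _](wordVK ws) -uE u1 id_lfunE.
Qed.

(** * Faces of an invariant cone generated by dominant points *)

Section InvariantCone.
Variable Y : set V.
Hypotheses (Ycone : convex_cone Y) (Y0 : Y 0).
Hypothesis Ys : forall i x, Y x -> Y (s i x).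
Hypothesis YX : forall y, Y y -> exists ws, exists2 c, dominant c & y = word ws c.

Definition dominant_faces : set (set V) :=
  [set F | exists r, [/\ Y r, dominant r & F = face_of Y r]].

Lemma dominant_faces_Fa : dominant_faces `<=` Fa Y.
Proof. by move=> _ [r [Yr _ ->]]; exact: face_of_Fa. Qed.

Lemma face_of_s i r : face_of Y (s i r) = [set s i x | x in face_of Y r].
Proof.
apply: face_of_img; first exact: (can_inj (@sK i)).
apply/seteqP; split=> [_ [x Yx <-]|x Yx]; first exact: Ys.
by exists (s i x); [exact: Ys|exact: sK].
Qed.

Lemma dominant_face_s A i x : dominant_faces A -> A x -> alpha i x < 0 -> A (s i x).
Proof.
move=> AU Ax ix; have AF := dominant_faces_Fa AU.
case: AU => r [Yr rC Ar].
have [[_ AY] AE _] := AF.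
have Yx : Y x by exact: AY.
have := rC i; rewrite le_eqVlt => /predU1P[/esym ir|ir].
  by rewrite Ar -(s_fix ir) face_of_s; exists x => //; rewrite -Ar.
(* With this [b], the point [x + b *: r] lies on wall [i]. *)
pose b := - alpha i x / alpha i r.
have b0 : 0 < b by rewrite divr_gt0// oppr_gt0.
have Az : A (s i x + b *: s i r).
  rewrite -linearZ -linearD /= s_fix; last first.
    by rewrite linearD linearZ /= divfK ?gt_eqF// subrr.
  apply: (face_cone AF).1 => //; apply: (face_cone AF).2 => //.
  by rewrite Ar; exact: face_of_self.
apply: contrapT => Asx.
have Ysr : Y (b *: s i r) by apply: Ycone.2 => //; exact: Ys.
by have [] := AE _ _ (conj (Ys i Yx) Asx) Ysr.
Qed.

(* Folding [x] towards the dominant chamber keeps it in the relative interior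
   of [M], because the midpoint of [x] and [s i x] is fixed by [s i]. *)
Lemma dominant_faceP M : Fa Y M ->
  (forall i x, M x -> alpha i x < 0 -> M (s i x)) -> dominant_faces M.
Proof.
move=> MF Ms; have [x0 Yx0 Mx0] := face_ofE Ycone Y0 MF.
have [ws [c cC x0E]] := YX Yx0; rewrite x0E in Yx0 Mx0.
(* Induction on the length of a word carrying a dominant point to a generator of [M]; each folding
   shortens it. *)
elim: {ws}(size ws).+1 {-2}ws (ltnSn (size ws)) Yx0 Mx0 {x0 x0E} => // m IH ws wsm.
set x := word ws c => Yx Mx.
have [xC|/existsNP[i /negP]] := pselect (dominant x); first by exists x.
rewrite -ltNge => ix; have [ws' ws'_lt ws'E] := deletion cC ix.
have Mxx : M x by rewrite Mx; exact: face_of_self.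
have Msx := Ms _ _ Mxx ix.
have Mp : M (x + s i x) by apply: (face_cone MF).1.
have Ysx := Ys i Yx.
have Yp : Y (x + s i x) by apply: Ycone.1.
have MpE : M = face_of Y (x + s i x).
  apply/seteqP; split; last exact: face_of_sub.
  rewrite Mx; apply: face_of_sub => //; first exact: face_of_Fa.
  by split=> //; exists 1 => //; rewrite scale1r addrC addKr.
apply: (IH ws'); first exact: leq_trans ws'_lt _.
  by rewrite -ws'E.
rewrite -ws'E face_of_s -/x -Mx {2}MpE -face_of_s.
by rewrite linearD /= sK addrC.
Qed.

Lemma dominant_faces_complete : complete_sublattice (Fa Y) dominant_faces.
Proof.
have C0 : dominant 0 by move=> i; rewrite linear0.
split.
- exact: dominant_faces_Fa.
- exists (face_of Y 0); first by exists 0.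
  by split=> [|A AF]; [exact: face_of_Fa|apply: face_of_sub => //; exact: face0 AF].
- exists Y; first by apply: dominant_faceP; [exact: Fa_full|move=> i x /Ys].
  by split=> [|A [[]]//]; exact: Fa_full.
- move=> S SU S0; have SF := subset_trans SU dominant_faces_Fa.
  have MF : Fa Y (\bigcap_(A in S) A) by exact: Fa_bigcap.
  exists (\bigcap_(A in S) A).
    apply: dominant_faceP => // i x Mx ix A SA.
    by apply: dominant_face_s => //; [exact: SU|exact: Mx].
  split=> [|B [_ BS] x Bx A SA]; last exact: BS Bx.
  by split=> // A SA x; exact.
- move=> S SU S0; have SF := subset_trans SU dominant_faces_Fa.
  pose ub := [set B | Fa Y B /\ forall A, S A -> A `<=` B].
  pose D := dominant `&` \bigcap_(B in ub) B.
  have ubY : ub Y by split=> [|A /SF[[]]//]; exact: Fa_full.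
  have Dcone : convex_cone D.
    split=> [x y [xC xB] [yC yB]|a x a0 [xC xB]].
      split=> [i|B Bub]; first by rewrite linearD addr_ge0.
      by apply: (face_cone Bub.1).1; [exact: xB|exact: yB].
    split=> [i|B Bub]; first by rewrite linearZ; exact: mulr_ge0 (ltW a0) (xC i).
    by apply: (face_cone Bub.1).2 => //; exact: xB.
  have D0 : D 0 by split=> // B [BF _]; exact: face0 BF.
  have [r [[rC rB] rD]] := cone_core_neq0 Dcone D0.
  have DY x : D x -> Y x by move=> [_]; exact.
  have Yr : Y r by exact: rB.
  exists (face_of Y r); first by exists r.
  split=> [|B Bub]; last by apply: face_of_sub => //; [exact: Bub.1|exact: rB].
  split=> [|A SA]; first exact: face_of_Fa.
  have [a [Ya aC AE]] := SU _ SA; rewrite AE.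
  apply: face_of_sub => //; first exact: face_of_Fa.
  (* Since [r] is in the core of [D], some [r - e *: a] is in [D], hence in [Y], which puts [a] in
     the face generated by [r]. *)
  have Da : D a by split=> // B [_ /(_ _ SA)]; rewrite AE; apply; exact: face_of_self.
  by split=> //; have [e e0 /DY] := rD _ Da; exists e.
Qed.

End InvariantCone.
End ReflectionGroups.

(** * Linear Coxeter systems *)

Definition reflection (R : realType) (V : vectType R) (a : {scalar V}) (d x : V) : V :=
  x - a x *: d.

Fact reflection_is_linear (R : realType) (V : vectType R) (a : {scalar V}) (d : V) :
  linear (reflection a d).
Proof.
move=> t x y; rewrite /reflection linearP /= scalerDl scalerBr scalerA.
by rewrite opprD addrACA.
Qed.

HB.instance Definition _ (R : realType) (V : vectType R) (a : {scalar V}) (d : V) :=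
  GRing.isLinear.Build R V V *:%R (reflection a d) (reflection_is_linear a d).

(** The canonical map from [h] to its bidual; the roots are evaluations at generators of the rays
    [H i]. *)
Definition evaluation (R : realType) (h : vectType R) (v : h) (f : dual h) : R :=
  (f : 'Hom(h, R^o)) v.

Fact evaluation_is_scalar (R : realType) (h : vectType R) (v : h) :
  scalar (evaluation v).
Proof. by move=> t f g; rewrite /evaluation lfunE /= lfunE. Qed.

HB.instance Definition _ (R : realType) (h : vectType R) (v : h) :=
  GRing.isLinear.Build R (dual h) R *%R (evaluation v) (evaluation_is_scalar v).

(** The span of [A] is a hyperplane without [d], because [a d] is nonzero. So [f] and a multiple of
    [a] agree everywhere once they agree at [d]. *)
Lemma codim1_annihilator (R : realType) (V : vectType R) (A : set V)
    (a f : {scalar V}) (d : V) :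
  codim1 A -> (forall x, A x -> a x = 0) -> a d != 0 ->
  (forall x, A x -> f x = 0) -> exists c : R, forall x, f x = c * a x.
Proof.
move=> [U UA dimU] aA ad0 fA.
have vanish (g : {scalar V}) : (forall x, A x -> g x = 0) -> forall u, u \in U -> g u = 0.
  move=> gA u uU; have : [set` U] u by [].
  rewrite UA => -[t tA] /(@coord_span _ _ _ (in_tuple t)) ->.
  rewrite linear_sum big1// => j _; rewrite linearZ /= gA ?mulr0//.
  exact/tA/mem_nth.
have dU : d \notin U by apply: contraNN ad0 => /(vanish _ aA) ->.
have UdV : (U + <[d]>)%VS = fullv.
  apply/eqP; rewrite eqEdim subvf /= dimv_disjoint_sum.
    rewrite -dimU dim_vline; case: eqVneq dU => [->|_ _]; first by rewrite mem0v.
    by rewrite addn1.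
  apply/eqP; rewrite -subv0; apply/subvP => x; rewrite memv_cap => /andP[xU /vlineP[t xt]].
  have [t0|t0] := eqVneq t 0; first by rewrite xt t0 scale0r mem0v.
  by move: dU; rewrite -[d](scalerK t0) -xt memvZ.
exists (f d / a d) => x; have : x \in (U + <[d]>)%VS by rewrite UdV memvf.
move=> /memv_addP[u uU [_ /vlineP[t ->] ->]].
rewrite !linearD !linearZ /= !(vanish _ _ _ uU)// !add0r.
by rewrite mulrCA divfK.
Qed.

Theorem theorem4p12 (R : realType) (h : vectType R) (n : nat)
  (H : 'I_n -> set h) (L : 'I_n -> set (dual h)) (Y : set (dual h))
  (hHL : linear_coxeter_system H L)
  (hYcone : convex_cone Y) (hY0 : Y 0) (hYX : Y `<=` tits_cone H L)
  (hYW : forall s, coxeter_group H L s -> [set s l | l in Y] = Y) :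
  complete_sublattice (Fa Y) (Upsilon H Y).
Proof.
case: hHL => _ Hray Lray Lpos Cspan facets facets_inj disj.
have /choice[v vP] i : exists v : h,
    v != 0 /\ H i = [set t *: v | t in [set t : R | 0 <= t]].
  by have [v] := Hray i; exists v.
have /choice[l lP] i : exists l : dual h,
    l != 0 /\ L i = [set t *: l | t in [set t : R | 0 <= t]].
  by have [l] := Lray i; exists l.
pose alpha i : {scalar dual h} := evaluation (v i).
have v0 i : v i != 0 by case: (vP i).
have HE i : H i = [set t *: v i | t in [set t : R | 0 <= t]] by case: (vP i).
have Hv i : H i (v i) by rewrite HE; exists 1; rewrite ?scale1r //=.
have evZ (t : R) i (f : dual h) : (f : 'Hom(h, R^o)) (t *: v i) = t * alpha i f.
  by rewrite linearZ.
have ge0E i f : ge0_on (H i) f <-> 0 <= alpha i f.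
  split=> [/(_ _ (Hv i))//|fi x]; rewrite HE => -[t t0 <-].
  by rewrite evZ mulr_ge0.
have gt0E i f : gt0_on (H i) f <-> 0 < alpha i f.
  split=> [/(_ _ (Hv i) (v0 i))//|fi x]; rewrite HE => -[t t0 <-].
  rewrite scaler_eq0 (negPf (v0 i)) orbF => tn0.
  by rewrite evZ mulr_gt0// lt_def tn0.
have eq0E i f : eq0_on (H i) f <-> alpha i f = 0.
  split=> [/(_ _ (Hv i))//|fi x]; rewrite HE => -[t t0 <-].
  by rewrite evZ fi mulr0.
have CE : closed_chamber H = dominant alpha.
  by apply/seteqP; split=> f fC i; [exact/ge0E/fC|move=> _; exact/ge0E/fC].
have CoE : open_chamber H = dominant_open alpha.
  by apply/seteqP; split=> f fC i; [exact/gt0E/fC|move=> _; exact/gt0E/fC].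
have Ll i : L i (l i).
  by case: (lP i) => _ ->; exists 1; rewrite ?scale1r //=.
have al0 i : 0 < alpha i (l i) by apply/gt0E/Lpos => //; case: (lP i).
have an0 i : alpha i (l i) != 0 by rewrite gt_eqF.
have alphaZ i t f : alpha i (t *: f) = t * alpha i f by exact: linearZ.
(* Scaled so that [alpha i (d i) = 2], which makes [s i] negate [L i]. *)
pose d i := (2 / alpha i (l i)) *: l i.
have alpha_d i : alpha i (d i) = 2 by rewrite alphaZ divfK.
pose s i : 'End(dual h) := linfun (reflection (alpha i) (d i)).
have sE i x : s i x = x - alpha i x *: d i by rewrite lfunE.
have facet i : codim1 (closed_chamber H `&` eq0_on (H i)).
  have : range (fun i => closed_chamber H `&` eq0_on (H i))
    (closed_chamber H `&` eq0_on (H i)) by exists i.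
  by rewrite -facets => -[].
have facetE i x : (closed_chamber H `&` eq0_on (H i)) x <->
    dominant alpha x /\ alpha i x = 0.
  by rewrite CE; split=> -[? /eq0E].
have wall_span i (f : {scalar dual h}) :
    (forall x, dominant alpha x -> alpha i x = 0 -> f x = 0) ->
    exists c : R, forall x, f x = c * alpha i x.
  move=> f0; apply: (codim1_annihilator (d := d i) (facet i)).
  - by move=> x /facetE[].
  - by rewrite alpha_d pnatr_eq0.
  - by move=> x /facetE[]; exact: f0.
have wall_inj i k :
    (forall x, dominant alpha x -> alpha i x = 0 <-> alpha k x = 0) -> i = k.
  move=> ik; apply: facets_inj; apply/seteqP.
  by split=> x /facetE[xC ix]; apply/facetE; split=> //; apply/ik.
have simpleE i g : simple_reflection H L i g <-> g = s i.
  split=> [[gfix gl]|->].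
    apply/lfunP => x; rewrite sE /d scalerA mulrCA.
    (* [x] splits into a part on the hyperplane, fixed by [g], and [t *: l i], negated by [g]. *)
    set t := alpha i x / alpha i (l i).
    have gx : g (x - t *: l i) = x - t *: l i.
      apply/gfix/eq0E; rewrite linearB linearZ.
      by apply/eqP; rewrite subr_eq0 eq_sym; exact/eqP/divfK/an0.
    have gt : g (t *: l i) = - (t *: l i).
      by rewrite linearZ /= gl ?scalerN.
    rewrite -{1}[x](subrK (t *: l i)) linearD /= gx gt.
    by rewrite -addrA -opprD -scalerDl mulr_natl mulr2n.
  split=> x; first by move=> /eq0E xi; rewrite sE xi scale0r subr0.
  case: (lP i) => _ -> [t _ <-]; rewrite sE /d scalerA.
  have -> : alpha i (t *: l i) * (2 / alpha i (l i)) = t + t.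
    by rewrite alphaZ [2 / _]mulrC mulrA mulfK// mulr_natr mulr2n.
  by rewrite scalerDl opprD addrA subrr add0r.
have s_simple i : simple_reflection H L i (s i) by exact/simpleE.
have word_group ws : coxeter_group H L (word s ws).
  elim: ws => [|i ws IH] G [GG sG]; first by case: GG.
  have [_ GM _] := GG; apply: GM; first by apply: sG; exists i.
  by apply: IH.
have group_word g : coxeter_group H L g -> exists ws, g = word s ws.
  (* The words form a group, reversal giving inverses, and the generated group is the smallest
     one. *)
  move=> gW; apply: (gW [set g | exists ws, g = word s ws]); split.
    split=> [|_ _ [ws1 ->] [ws2 ->]|_ [ws ->]]; first by exists [::].
      by exists (ws1 ++ ws2); apply/lfunP => x; rewrite comp_lfunE word_cat.
    exists (word s (rev ws)); split; first by exists (rev ws).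
      by apply/lfunP => x; rewrite comp_lfunE id_lfunE (wordVK alpha_d sE).
    by apply/lfunP => x; rewrite comp_lfunE id_lfunE (wordK alpha_d sE).
  move=> _ [i /simpleE ->]; exists [:: i]; apply/lfunP => x.
  by rewrite /= comp_lfunE id_lfunE.
have word_disjoint ws x : dominant_open alpha x ->
    dominant_open alpha (word s ws x) -> word s ws = \1%VF.
  rewrite -CoE => xC wxC; apply: contrapT => /(disj _ (word_group ws)).
  by move=> /seteqP[/(_ (word s ws x))+ _]; apply; split=> //; exists x.
have Ys i x : Y x -> Y (s i x).
  move=> Yx; rewrite -(hYW (s i)); first by exists x.
  by move=> G [_]; apply; exists i.
have YX y : Y y -> exists ws, exists2 c, dominant alpha c & y = word s ws c.
  move=> /hYX[g /group_word[ws ->] [c]]; rewrite CE => cC <-.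
  by exists ws, c.
have -> : Upsilon H Y = dominant_faces alpha Y.
  apply/seteqP; split=> [F [FY [r [/(relint_faceP hYcone hY0 _ FY)[Yr ->] rC]]]|].
    by exists r; split=> //; rewrite -CE.
  move=> _ [r [Yr rC ->]]; have FY := face_of_Fa hYcone hY0 Yr.
  split=> //; exists r; split; last by rewrite CE.
  exact/(relint_faceP hYcone hY0 _ FY).
rewrite CE in Cspan.
exact: (dominant_faces_complete alpha_d sE Cspan wall_span wall_inj word_disjoint).
Qed.
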